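(* Let $F$ be a real Hilbert space and let the model sets be the hyperellipsoidal sets $$\mathcal{K}_0=\{g\in F:\|P_0g\|\le\varepsilon_0\},\qquad\mathcal{K}_1=\{g\in F:\|P_1g\|\le\varepsilon_1\},$$ where $\varepsilon_0,\varepsilon_1>0$ and $P_0,P_1$ are linear maps from $F$ into Hilbert spaces. Let $\Lambda_0:F\to\mathbb{R}^{m_0}$ and $\Lambda_1:F\to\mathbb{R}^{m_1}$ be linear observation maps. Suppose also that $\ker(\Lambda_0)\subseteq\ker(P_1)$ or $\ker(\Lambda_0)\subseteq\ker(\Lambda_1)$. If the linear quantity of interest $Q:F\to Z$ maps into a Hilbert space $Z$, then a locally optimal recovery map is given by $\Delta^{\rm opt}:y=[y_0;y_1]\in\mathbb{R}^{m_0+m_1}\mapsto Q(f_0^{\tau^y})\in Z$, where $$[f_0^\tau;f_1^\tau]:=\underset{[f_0;f_1]\in F\times F}{\rm argmin}\ \left[(1-\tau)\|P_0f_0\|^2+\tau\|P_1(f_0-f_1)\|^2\right]\quad\text{subject to}\quad\Lambda_0f_0=y_0,\ \Lambda_1f_1=y_1.$$ Here, the regularization parameter is $\tau^y=c_1^y/(c_0^y+c_1^y)$, with $b^y,c_0^y,c_1^y\ge0$ being solutions to the following semidefinite program, in which $\mathcal{N}_0:=\ker(\Lambda_0)$, $\mathcal{N}_1:=\ker(\Lambda_1)$, $u_0:=P_0\Lambda_0^\dagger y_0$, and $u_1:=P_1(\Lambda_0^\dagger y_0-\Lambda_1^\dagger y_1)$: $$\underset{b,c_0,c_1\ge0}{\rm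 minimize}\quad c_0\big(\varepsilon_0^2-\|u_0\|^2\big)+c_1\big(\varepsilon_1^2-\|u_1\|^2\big)+b$$ subject to $$\begin{bmatrix}c_0P_{0,\mathcal{N}_0}^*P_{0,\mathcal{N}_0}+c_1P_{1,\mathcal{N}_0}^*P_{1,\mathcal{N}_0}&-c_1P_{1,\mathcal{N}_0}^*P_{1,\mathcal{N}_1}\\-c_1P_{1,\mathcal{N}_1}^*P_{1,\mathcal{N}_0}&c_1P_{1,\mathcal{N}_1}^*P_{1,\mathcal{N}_1}\end{bmatrix}\succeq\begin{bmatrix}Q_{\mathcal{N}_0}^*Q_{\mathcal{N}_0}&0\\0&0\end{bmatrix}$$ and $$\begin{bmatrix}c_0P_{0,\mathcal{N}_0}^*P_{0,\mathcal{N}_0}+c_1P_{1,\mathcal{N}_0}^*P_{1,\mathcal{N}_0}&-c_1P_{1,\mathcal{N}_0}^*P_{1,\mathcal{N}_1}&c_0P_{0,\mathcal{N}_0}^*u_0+c_1P_{1,\mathcal{N}_0}^*u_1\\-c_1P_{1,\mathcal{N}_1}^*P_{1,\mathcal{N}_0}&c_1P_{1,\mathcal{N}_1}^*P_{1,\mathcal{N}_1}&-c_1P_{1,\mathcal{N}_1}^*u_1\\(c_0P_{0,\mathcal{N}_0}^*u_0+c_1P_{1,\mathcal{N}_0}^*u_1)^*&-(c_1P_{1,\mathcal{N}_1}^*u_1)^*&b\end{bmatrix}\succeq0.$$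
   Context: An unknown $f_0\in F$ and a related $f_1\in F$ satisfy $f_0\in\mathcal{K}_0$, $f_0-f_1\in\mathcal{K}_1$ and are observed through $y_0=\Lambda_0f_0$, $y_1=\Lambda_1f_1$. For $y=[y_0;y_1]\in\mathbb{R}^{m_0+m_1}$ and $z\in Z$, the local worst-case error is $${\rm lwce}_y(z)=\sup\big\{\|Q(f_0)-z\|_Z:\ \|P_0f_0\|\le\varepsilon_0,\ \|P_1(f_0-f_1)\|\le\varepsilon_1,\ \Lambda_0f_0=y_0,\ \Lambda_1f_1=y_1\big\}.$$ A map $\Delta:\mathbb{R}^{m_0+m_1}\to Z$ is locally optimal if, for every $y$, $\Delta(y)$ minimizes ${\rm lwce}_y(z)$ over all $z\in Z$. For a linear map $A$ on $F$ and a subspace $\mathcal{N}$, $A_{\mathcal{N}}$ (also written $P_{0,\mathcal{N}},P_{1,\mathcal{N}}$ for $A=P_0,P_1$) denotes the restriction of $A$ to $\mathcal{N}$; ${}^*$ denotes the adjoint, ${}^\dagger$ the Moore–Penrose pseudo-inverse, and $A\succeq B$ means that $A-B$ is positive semidefinite. Block operators act on $\mathcal{N}_0\times\mathcal{N}_1$, respectively $\mathcal{N}_0\times\mathcal{N}_1\times\mathbb{R}$. Standing assumptions. All linear maps are bounded. It is assumed that $P_0f_0=0$, $P_1(f_0-f_1)=0$, $\Lambda_0f_0=0$, $\Lambda_1f_1=0$ together imply $f_0=0$ and $f_1=0$; when $\dim F=\infty$, it is assumed instead that there is $\delta>0$ such that $\max\{\tfrac1{\varepsilon_0}\|P_0h_0\|,\tfrac1{\varepsilon_1}\|P_1(h_0-h_1)\|\}\ge\delta\,\|[h_0;h_1]\|$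 for all $h_0\in\ker(\Lambda_0)$, $h_1\in\ker(\Lambda_1)$. The relevant data vectors $y$ are those for which some $(f_0,f_1)$ satisfies all model and data constraints, and it is understood that $c_0^y+c_1^y>0$, so that $\tau^y$ is defined. *)

(* Defs.v *)
From HB Require Import structures.
From mathcomp Require Import all_boot all_order all_algebra.
From mathcomp Require Import all_classical all_reals all_analysis.

Set Implicit Arguments.
Unset Strict Implicit.
Unset Printing Implicit Defensive.

Import Order.TTheory GRing.Theory Num.Theory.
Import numFieldNormedType.Exports.

Local Open Scope classical_set_scope.
Local Open Scope ring_scope.

(* Real inner product spaces are kept separate from normed modules: products
   and kernels below carry an inner product, whereas the library norm on a
   product (and on matrices) is the max norm. *)

HB.mixin Record hasInner (R : realType) V & GRing.Lmodule R V := {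
  inner : V -> V -> R ;
  innerC : forall u v, inner u v = inner v u ;
  innerDl : forall u v w, inner (u + v) w = inner u w + inner v w ;
  innerZl : forall a u v, inner (a *: u) v = a * inner u v ;
  inner_gt0 : forall u, u != 0 -> 0 < inner u u
}.

#[short(type="innerType")]
HB.structure Definition InnerSpace (R : realType) :=
  {V of GRing.Lmodule R V & hasInner R V}.

HB.mixin Record Inner_isHilbert (R : realType) V
    & CompleteNormedModule R V & hasInner R V := {
  sqr_norm_inner : forall u : V, `|u| ^+ 2 = inner u u
}.

#[short(type="hilbertType")]
HB.structure Definition Hilbert (R : realType) :=
  {V of CompleteNormedModule R V & InnerSpace R V & Inner_isHilbert R V}.

Arguments inner {R V} : rename.

Definition inorm (R : realType) (V : innerType R) (u : V) : R :=
  Num.sqrt (inner u u).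

Section inner0.
Context (R : realType) (V : innerType R).

Lemma inner0l (v : V) : inner 0 v = 0 :> R.
Proof. by rewrite -(scale0r v) innerZl mul0r. Qed.

Lemma inner_ge0 (v : V) : 0 <= inner v v :> R.
Proof.
have [->|v0] := eqVneq v 0; first by rewrite inner0l.
exact/ltW/inner_gt0.
Qed.

End inner0.

Section inner_regular.
Context (R : realType).

Let op (x y : R^o) : R := x * y.
Let opC u v : op u v = op v u. Proof. exact: mulrC. Qed.
Let opDl u v w : op (u + v) w = op u w + op v w. Proof. exact: mulrDl. Qed.
Let opZl a u v : op (a *: u) v = a * op u v.
Proof. by rewrite /op mulrA. Qed.
Let op_gt0 u : u != 0 -> 0 < op u u.
Proof. by rewrite /op -expr2 exprn_even_gt0. Qed.

HB.instance Definition _ := hasInner.Build R R^o opC opDl opZl op_gt0.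

End inner_regular.

Section inner_matrix.
Context (R : realType) (m n : nat).

Let op (A B : 'M[R]_(m, n)) : R := \sum_i \sum_j A i j * B i j.
Let opC u v : op u v = op v u.
Proof. by apply: eq_bigr => i _; apply: eq_bigr => j _; rewrite mulrC. Qed.
Let opDl u v w : op (u + v) w = op u w + op v w.
Proof.
rewrite /op -big_split; apply: eq_bigr => i _; rewrite -big_split.
by apply: eq_bigr => j _; rewrite mxE mulrDl.
Qed.
Let opZl a u v : op (a *: u) v = a * op u v.
Proof.
rewrite /op mulr_sumr; apply: eq_bigr => i _; rewrite mulr_sumr.
by apply: eq_bigr => j _; rewrite mxE mulrA.
Qed.
Let op_gt0 u : u != 0 -> 0 < op u u.
Proof.
have ge0 i j : 0 <= u i j * u i j by rewrite -expr2 sqr_ge0.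
have row_ge0 i : 0 <= \sum_j u i j * u i j by apply: sumr_ge0 => j _.
rewrite lt_def => u0; apply/andP; split; last exact: sumr_ge0.
apply: contra u0 => /eqP op0; apply/eqP/matrixP => i j.
have rowi0 : \sum_j u i j * u i j = 0.
  by apply: (psumr_eq0P _ op0) => // k _; exact: row_ge0.
have /eqP : u i j * u i j = 0 by apply: (psumr_eq0P _ rowi0) => // k _.
by rewrite mulf_eq0 orbb mxE => /eqP.
Qed.

HB.instance Definition _ := hasInner.Build R 'M[R]_(m, n) opC opDl opZl op_gt0.

End inner_matrix.

Section inner_prod.
Context (R : realType) (U V : innerType R).

Let op (x y : U * V) : R := inner x.1 y.1 + inner x.2 y.2.
Let opC u v : op u v = op v u.
Proof. by rewrite /op innerC (innerC u.2). Qed.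
Let opDl u v w : op (u + v) w = op u w + op v w.
Proof. by rewrite /op !innerDl addrACA. Qed.
Let opZl a u v : op (a *: u) v = a * op u v.
Proof. by rewrite /op !innerZl mulrDr. Qed.
Let op_gt0 u : u != 0 -> 0 < op u u.
Proof.
case: u => u v; rewrite /op /= -pair_eqE /= negb_and => /orP[] uv0.
  by rewrite ltr_pwDl ?inner_gt0 ?inner_ge0.
by rewrite ltr_wpDl ?inner_gt0 ?inner_ge0.
Qed.

HB.instance Definition _ :=
  hasInner.Build R (U * V)%type opC opDl opZl op_gt0.

End inner_prod.

Definition ker (U V : nmodType) (A : U -> V) : set U := [set u | A u = 0].

Definition in_kernel (R : realType) (U V : lmodType R) (L : {linear U -> V})
  : {pred U} := fun u => L u == 0.

Section in_kernel_closed.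
Context (R : realType) (U V : lmodType R) (L : {linear U -> V}).

Fact in_kernel_submod : submod_closed (in_kernel L).
Proof.
split=> [|a u v]; rewrite /in_kernel !unfold_in ?linear0 //.
by move=> /eqP u0 /eqP v0; rewrite linearP u0 v0 scaler0 addr0.
Qed.

HB.instance Definition _ :=
  GRing.isSubmodClosed.Build R U (in_kernel L) in_kernel_submod.

End in_kernel_closed.

(* ker L as a space of its own, with the inner product induced by U *)
Record kernel (R : realType) (U V : lmodType R) (L : {linear U -> V}) :=
  Kernel { kernel_val :> U ; _ : in_kernel L kernel_val }.

Section kernel_lmod.
Context (R : realType) (U V : lmodType R) (L : {linear U -> V}).

HB.instance Definition _ := [isSub for @kernel_val R U V L].
HB.instance Definition _ := [Choice of kernel L by <:].
HB.instance Definition _ := [SubChoice_isSubLmodule of kernel L by <:].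

End kernel_lmod.

Section inner_kernel.
Context (R : realType) (U : innerType R) (V : lmodType R) (L : {linear U -> V}).

Let op (x y : kernel L) : R := inner (val x) (val y).
Let opC u v : op u v = op v u. Proof. exact: innerC. Qed.
Let opDl u v w : op (u + v) w = op u w + op v w. Proof. exact: innerDl. Qed.
Let opZl a u v : op (a *: u) v = a * op u v. Proof. exact: innerZl. Qed.
Let op_gt0 u : u != 0 -> 0 < op u u.
Proof. by move=> u0; apply: inner_gt0; rewrite -val_eqE in u0. Qed.

HB.instance Definition _ := hasInner.Build R (kernel L) opC opDl opZl op_gt0.

End inner_kernel.

Definition restr (R : realType) (U V W : lmodType R) (L : {linear U -> V})
  (A : U -> W) : kernel L -> W := fun h => A (val h).
Arguments restr {R U V W} L A.

Section operators.
Context {R : realType}.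

(* The representing vector is unique; it exists for every v as soon as U is
   complete and A is linear and bounded. *)
Definition adjoint (U V : innerType R) (A : U -> V) : V -> U :=
  fun v => xget 0 [set w | forall u, inner (A u) v = inner u w].

(* The Penrose equations have exactly one linear solution X when A is linear
   and bounded with closed range, in particular when V is finite-dimensional.
   The inner product of 'cV[R]_m is the Euclidean one. *)
Definition is_pinv (U V : innerType R) (A : U -> V) (X : V -> U) : Prop :=
  [/\ A \o X \o A = A,
      X \o A \o X = X,
      forall v w, inner (A (X v)) w = inner v (A (X w)) &
      forall t u, inner (X (A t)) u = inner t (X (A u))].

Definition pinv (U V : innerType R) (A : U -> V) : V -> U :=
  xget (fun=> 0) [set X | linear X /\ is_pinv A X].

Definition psd (U : innerType R) (T : U -> U) : Prop :=
  (forall u v, inner (T u) v = inner u (T v)) /\ (forall u, 0 <= inner (T u) u).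

Definition succeq (U : innerType R) (S T : U -> U) : Prop :=
  psd (fun u => S u - T u).

Definition block2 (U V : lmodType R)
    (A : U -> U) (B : V -> U)
    (C : U -> V) (D : V -> V) : U * V -> U * V :=
  fun x => (A x.1 + B x.2, C x.1 + D x.2).

Definition block3 (U V W : lmodType R)
    (A11 : U -> U) (A12 : V -> U) (A13 : W -> U)
    (A21 : U -> V) (A22 : V -> V) (A23 : W -> V)
    (A31 : U -> W) (A32 : V -> W) (A33 : W -> W)
    : U * V * W -> U * V * W :=
  fun x => (A11 x.1.1 + A12 x.1.2 + A13 x.2,
            A21 x.1.1 + A22 x.1.2 + A23 x.2,
            A31 x.1.1 + A32 x.1.2 + A33 x.2).

(* A vector as an operator from the scalars; its adjoint is the functional
   represented by v. *)
Definition col_op (U : lmodType R) (v : U) : R^o -> U := fun s => s *: v.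

Definition finite_dim (V : lmodType R) : Prop :=
  exists (n : nat) (e : 'I_n -> V),
    forall v, exists a : 'I_n -> R, v = \sum_i a i *: e i.

End operators.

Section recovery.
Context {R : realType} {F H0 H1 Z : hilbertType R} {m0 m1 : nat}.
Context (P0 : {linear F -> H0}) (P1 : {linear F -> H1}).
Context (L0 : {linear F -> 'cV[R]_m0}) (L1 : {linear F -> 'cV[R]_m1}).
Context (Q : {linear F -> Z}) (eps0 eps1 : R).

Definition model0 : set F := [set g | `|P0 g| <= eps0].
Definition model1 : set F := [set g | `|P1 g| <= eps1].

(* y is the stacked vector [y0; y1]: usubmx y = y0 and dsubmx y = y1 *)
Definition data_consistent (y : 'cV[R]_(m0 + m1)) : set (F * F) :=
  [set f | L0 f.1 = usubmx y /\ L1 f.2 = dsubmx y].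

Definition compatible (y : 'cV[R]_(m0 + m1)) : set (F * F) :=
  [set f | [/\ model0 f.1, model1 (f.1 - f.2) & data_consistent y f]].

(* Extended-real valued; -oo when no pair is compatible with y *)
Definition lwce (y : 'cV[R]_(m0 + m1)) (z : Z) : \bar R :=
  ereal_sup [set (`|Q f.1 - z|)%:E | f in compatible y].

Definition locally_optimal_on (D : set 'cV[R]_(m0 + m1))
    (Delta : 'cV[R]_(m0 + m1) -> Z) : Prop :=
  forall y, D y -> forall z, (lwce y (Delta y) <= lwce y z)%E.

(* inorm (h0, h1) is the Hilbert norm of F * F, unlike `|(h0, h1)|. *)
Definition well_posed : Prop :=
  (finite_dim F ->
     forall f0 f1, P0 f0 = 0 -> P1 (f0 - f1) = 0 -> L0 f0 = 0 -> L1 f1 = 0 ->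
     f0 = 0 /\ f1 = 0) /\
  (~ finite_dim F ->
     exists2 delta : R, 0 < delta &
     forall h0 h1, ker L0 h0 -> ker L1 h1 ->
     delta * inorm ((h0, h1) : F * F) <=
       Num.max (eps0^-1 * `|P0 h0|) (eps1^-1 * `|P1 (h0 - h1)|)).

Definition regularized (tau : R) (f : F * F) : R :=
  (1 - tau) * `|P0 f.1| ^+ 2 + tau * `|P1 (f.1 - f.2)| ^+ 2.

(* A set: for tau = 0 the second component of a minimizer, and for tau = 1
   the first one, need not be unique. *)
Definition argmin_regularized (tau : R) (y : 'cV[R]_(m0 + m1)) : set (F * F) :=
  [set f | data_consistent y f /\
    forall g, data_consistent y g -> regularized tau f <= regularized tau g].

Definition sdp_u0 (y : 'cV[R]_(m0 + m1)) : H0 := P0 (pinv L0 (usubmx y)).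
Definition sdp_u1 (y : 'cV[R]_(m0 + m1)) : H1 :=
  P1 (pinv L0 (usubmx y) - pinv L1 (dsubmx y)).

Definition sdp_objective (y : 'cV[R]_(m0 + m1)) (b c0 c1 : R) : R :=
  c0 * (eps0 ^+ 2 - `|sdp_u0 y| ^+ 2) + c1 * (eps1 ^+ 2 - `|sdp_u1 y| ^+ 2) + b.

Local Notation P00 := (restr L0 P0).
Local Notation P10 := (restr L0 P1).
Local Notation P11 := (restr L1 P1).
Local Notation Q0 := (restr L0 Q).

Definition sdp_constraint1 (c0 c1 : R) : Prop :=
  succeq
    (block2
      (fun h => c0 *: adjoint P00 (P00 h) + c1 *: adjoint P10 (P10 h))
      (fun h => - (c1 *: adjoint P10 (P11 h)))
      (fun h => - (c1 *: adjoint P11 (P10 h)))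
      (fun h => c1 *: adjoint P11 (P11 h)))
    (block2 (fun h => adjoint Q0 (Q0 h)) (fun=> 0) (fun=> 0) (fun=> 0)).

Definition sdp_constraint2 (y : 'cV[R]_(m0 + m1)) (b c0 c1 : R) : Prop :=
  let u0 := sdp_u0 y in
  let u1 := sdp_u1 y in
  let v0 := c0 *: adjoint P00 u0 + c1 *: adjoint P10 u1 in
  let v1 := c1 *: adjoint P11 u1 in
  succeq
    (block3
      (fun h => c0 *: adjoint P00 (P00 h) + c1 *: adjoint P10 (P10 h))
      (fun h => - (c1 *: adjoint P10 (P11 h)))
      (col_op v0)
      (fun h => - (c1 *: adjoint P11 (P10 h)))
      (fun h => c1 *: adjoint P11 (P11 h))
      (col_op (- v1))
      (adjoint (col_op v0))
      (fun h => - adjoint (col_op v1) h)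
      (fun s : R^o => b *: s))
    (fun=> 0).

Definition sdp_feasible (y : 'cV[R]_(m0 + m1)) (b c0 c1 : R) : Prop :=
  [/\ 0 <= b, 0 <= c0, 0 <= c1, sdp_constraint1 c0 c1
    & sdp_constraint2 y b c0 c1].

Definition sdp_solution (y : 'cV[R]_(m0 + m1)) (b c0 c1 : R) : Prop :=
  sdp_feasible y b c0 c1 /\
  forall b' c0' c1', sdp_feasible y b' c0' c1' ->
    sdp_objective y b c0 c1 <= sdp_objective y b' c0' c1'.

End recovery.

(* Main.v *)
Require Import Defs.
From HB Require Import structures.
From mathcomp Require Import all_boot all_order all_algebra.
From mathcomp Require Import all_classical all_reals all_analysis.
From mathcomp Require Import ring lra.

Import Order.TTheory GRing.Theory Num.Theory.
Import numFieldNormedType.Exports.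

Local Open Scope classical_set_scope.
Local Open Scope ring_scope.

(** Each of the two kernel inclusions implies P1 (ker L0) `<=` P1 (ker L1):
    whatever h0 in ker L0 is added to f0, some h1 in ker L1 can be added to f1
    so that P1 (f0 - f1) does not change. Two consequences follow.

    First, the penalties |P0 f0|^2 and |P1 (f0 - f1)|^2 can be minimized one
    after the other over the data-consistent pairs: take f0 of least |P0 f0|
    with L0 f0 = y0, and then fit f1 to this f0. The resulting pair f minimizes
    both penalties simultaneously, hence every convex combination of them, and
    Pythagoras (regularized_stationary) measures how far another pair is from
    optimal. Existence of f is a least-squares problem on ker L0 and one on
    ker L1 (constrained_normal_equation): in finite dimension by
    Gram-Schmidt, in infinite dimension from the coercivity contained in
    well-posedness, by the direct method (coercive_variational).

    Secondly, the compatible first components form a set symmetric about f.1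
    (compatible_reflect): they are cut out by |P0 _| <= eps0, which is an
    ellipsoid centered at f.1 on the affine space of data-consistent vectors,
    and by a condition on P1 (f0 - f1) that the second component can restore
    after a reflection. The image under Q is then symmetric about Q f.1, which
    makes Q f.1 a minimizer of the worst-case error (lwce_stationary_le).

    It remains to see that every regularized minimizer for the parameter
    c1 / (c0 + c1) has image Q f.1. The first matrix inequality of the
    semidefinite program says |Q h0|^2 <= c0 |P0 h0|^2 + c1 |P1 (h0 - h1)|^2 on
    ker L0 x ker L1 (sdp_constraint1_le). For two minimizers the first term is
    zero at the difference h0 of their first components, and the second is
    zero for the compensating h1; so Q h0 = 0
    (argmin_regularized_stationary). *)

(** * Inner products *)

Section InnerTheory.
Context {R : realType} {V : innerType R}.
Implicit Types u v w : V.

Lemma innerDr u v w : inner u (v + w) = inner u v + inner u w.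
Proof. by rewrite innerC innerDl !(innerC u). Qed.

Lemma innerZr a u v : inner u (a *: v) = a * inner u v.
Proof. by rewrite innerC innerZl innerC. Qed.

Lemma innerNl u v : inner (- u) v = - inner u v.
Proof. by rewrite -scaleN1r innerZl mulN1r. Qed.

Lemma innerNr u v : inner u (- v) = - inner u v.
Proof. by rewrite innerC innerNl innerC. Qed.

Lemma inner0r u : inner u 0 = 0.
Proof. by rewrite innerC inner0l. Qed.

Lemma inner_sumr (I : Type) (r : seq I) (f : I -> V) v :
  inner v (\sum_(i <- r) f i) = \sum_(i <- r) inner v (f i).
Proof. exact: (big_morph _ (innerDr v) (inner0r v)). Qed.

Lemma inner_eq0 u : inner u u = 0 -> u = 0.
Proof. by apply: contra_eq => /inner_gt0; rewrite lt0r => /andP[]. Qed.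

End InnerTheory.

Section HilbertNorm.
Context {R : realType} {H : hilbertType R}.
Implicit Types u v w : H.

Lemma sqr_normD u v :
  `|u + v| ^+ 2 = `|u| ^+ 2 + 2 * inner u v + `|v| ^+ 2.
Proof.
rewrite !sqr_norm_inner innerDl !innerDr (innerC v u); ring.
Qed.

Lemma polarization u v : inner u v = (`|u + v| ^+ 2 - `|u - v| ^+ 2) / 4.
Proof. by rewrite !sqr_normD innerNr normrN; field. Qed.

Lemma inner_le_sqr_norm u v : 2 * inner u v <= `|u| ^+ 2 + `|v| ^+ 2.
Proof.
have := sqr_ge0 `|u - v|; rewrite sqr_normD innerNr normrN; lra.
Qed.

End HilbertNorm.

(** The first-order condition at a minimizer: a parabola through 0 that stays
    nonnegative has slope 0 there. *)
Lemma quadratic_ge0_eq0 {R : realType} (a b : R) :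
  (forall t, 0 <= t ^+ 2 * a + 2 * t * b) -> b = 0.
Proof.
move=> q; have a1 : 0 < `|a| + 1 by rewrite ltr_wpDl.
(* The minimizing t would be - b / a; the denominator is enlarged to cover
   a <= 0, and the value at this t is still negative unless b = 0. *)
have := q (- b / (`|a| + 1)).
have -> : (- b / (`|a| + 1)) ^+ 2 * a + 2 * (- b / (`|a| + 1)) * b =
   b ^+ 2 * (a - 2 * (`|a| + 1)) / (`|a| + 1) ^+ 2.
  by field; rewrite gt_eqF.
rewrite ler_pdivlMr ?exprn_gt0// mul0r => h.
have aa := ler_norm a; have na := normr_ge0 a.
have : b ^+ 2 <= 0 by nra.
by rewrite le_eqVlt ltNge sqr_ge0 orbF sqrf_eq0 => /eqP.
Qed.

(** * Quadratic minimization over a closed subspace *)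

Section Variational.
Context {R : realType} {F H G : hilbertType R} {V : normedModType R}.
Context (L : {linear F -> V}) (T : {linear F -> H}) (S : {linear F -> G}).
Context (v : G) (d : R).
Hypotheses (Lc : continuous L) (Tc : continuous T) (Sc : continuous S).
Hypotheses (d0 : 0 < d) (dT : forall u, ker L u -> d * `|u| <= `|T u|).

Let J u : R := `|T u| ^+ 2 - 2 * inner (S u) v.

(* Polarization reduces continuity of the inner product to that of the norm. *)
Let Jcont : continuous J.
Proof.
have JE : J = fun u => `|T u| * `|T u| - 2^-1 *
   (`|S u + v| * `|S u + v| - `|S u - v| * `|S u - v|).
  by apply/funext => u; rewrite /J polarization; field.
rewrite JE => u.
have nT : {for u, continuous (fun x => `|T x|)} by apply: cvg_norm; exact: Tc.
have nS w : {for u, continuous (fun x => `|S x + w|)}.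
  by apply: cvg_norm; apply: cvgD; [exact: Sc|exact: cvg_cst].
apply: cvgB; first exact: cvgM.
apply: cvgM; first exact: cvg_cst.
by apply: cvgB; (apply: cvgM; [exact: nS|exact: nS]).
Qed.

Let J_lb : exists m, forall u, ker L u -> m <= J u.
Proof.
have : bounded_near S (nbhs 0) by exact/linear_bounded_continuous.
move=> /linear_boundedP/pinfty_ex_gt0[M M0 SM].
(* The weight d / M is chosen so that coercivity of T absorbs |S u|. *)
exists (- `|(d / M)^-1 *: v| ^+ 2) => u Lu.
have := inner_le_sqr_norm ((d / M) *: S u) ((d / M)^-1 *: v).
have dM : 0 < d / M by rewrite divr_gt0.
rewrite innerZl innerZr mulVKf ?gt_eqF// normrZ (gtr0_norm dM).
have le1 : (d / M) * `|S u| <= `|T u|.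
  apply: le_trans (dT _ Lu).
  by rewrite -mulrA ler_pM2l// ler_pdivrMl.
have : ((d / M) * `|S u|) ^+ 2 <= `|T u| ^+ 2.
  by apply: lerXn2r => //; rewrite nnegrE // mulr_ge0 // ltW.
by rewrite /J; lra.
Qed.

Let parallelogram_J u w : `|T (u - w)| ^+ 2 =
  2 * J u + 2 * J w - 4 * J (2^-1 *: (u + w)).
Proof.
have TB : T (u - w) = T u - T w by exact: linearB.
have hD (W : hilbertType R) (A : {linear F -> W}) :
    A (2^-1 *: (u + w)) = 2^-1 *: (A u + A w) by rewrite linearZ linearD.
rewrite /J TB !hD.
rewrite innerZl innerDl normrZ.
rewrite !exprMn !sqr_normD innerNr normrN ger0_norm ?invr_ge0 ?ler0n//.
by field.
Qed.

(** Lax-Milgram for the symmetric form <T u, T w> and the functional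
    <S u, v> on ker L. The functional J is bounded below there because T
    dominates the norm; by the parallelogram identity near-minimizers of J are
    close to one another, so they converge, ker L being closed and F complete,
    and the first variation of J at the limit is the stated equation. With T
    the identity this is the Riesz representation theorem on ker L; with
    S = T it is the normal equation of a least-squares problem. *)
Lemma coercive_variational : exists2 w, ker L w &
  forall u, ker L u -> inner (T w) (T u) = inner (S u) v.
Proof.
have kerL0 : ker L 0 by rewrite /ker /= linear0.
pose E := J @` ker L.
have hE : has_inf E.
  split; first by exists (J 0), 0.
  by have [m Jm] := J_lb; exists m => _ [u Lu <-]; exact: Jm.
pose m := inf E.
have Jm u : ker L u -> m <= J u.
  by move=> Lu; apply: ge_inf; [exact: hE.2|exists u].
pose B e := [set u | ker L u /\ J u < m + e].
pose Fm := filter_from [set e : R | 0 < e] B.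
have B0 e : 0 < e -> B e !=set0.
  move=> e0; have [_ [u Lu <-] Ju] := inf_adherent e0 hE.
  by exists u.
have FF : ProperFilter Fm.
  apply: filter_from_proper => //; apply: filter_from_filter.
    by exists 1 => /=.
  move=> i j /= i0 j0; exists (Num.min i j) => /=; first by rewrite lt_min i0.
  move=> u [Lu]; rewrite /B /= addrC -ltrBDr lt_min !ltrBDr !(addrC _ m).
  by move=> /andP[].
have : cvg Fm.
  apply/cauchy_cvgP/cauchy_exP => e e0.
  pose e' := (d * e) ^+ 2 / 4.
  have e'0 : 0 < e' by rewrite divr_gt0// exprn_gt0// mulr_gt0.
  have [u [Lu Ju]] := B0 _ e'0; exists u; exists e' => //= w [Lw Jw].
  rewrite -ball_normE /=.
  have Luw : ker L (u - w) by rewrite /ker /= linearB Lu Lw subrr.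
  have Lm : ker L (2^-1 *: (u + w)).
    by rewrite /ker /= linearZ /= linearD Lu Lw addr0 scaler0.
  rewrite -(ltr_pM2l d0); apply: le_lt_trans (dT _ Luw) _.
  rewrite -(ltr_pXn2r (ltn0Sn 1)) ?nnegrE ?normr_ge0 ?mulr_ge0 ?ltW//.
  rewrite parallelogram_J; have := Jm _ Lm.
  have -> : (d * e) ^+ 2 = 4 * e' by rewrite /e'; field.
  lra.
move=> /cvg_ex[w Fw].
have Lw : ker L w.
  have cl : closed (ker L).
    apply: (@preimage_closed _ _ L [set 0]).
      by move=> x _; exact: Lc.
    exact/accessible_closed_set1/hausdorff_accessible/norm_hausdorff.
  by apply: (@closed_cvg _ _ Fm _ id _ cl _ _ Fw); exists 1 => //= x [].
have Jw : J w <= m.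
  apply/ler_addgt0Pr => e e0.
  have JFw : J x @[x --> Fm] --> J w by move=> A /Jcont /Fw.
  apply: (@closed_cvg _ _ Fm _ J _ (@closed_le R (m + e)) _ _ JFw).
  by exists e => //= x [_ /ltW].
exists w => // u Lu; apply/eqP; rewrite -subr_eq0; apply/eqP.
apply: (@quadratic_ge0_eq0 _ (`|T u| ^+ 2)) => t.
have : m <= J (w + t *: u).
  by apply: Jm; rewrite /ker /= linearD linearZ /= Lw Lu scaler0 addr0.
move/(le_trans Jw).
have hD (W : hilbertType R) (A : {linear F -> W}) :
    A (w + t *: u) = A w + t *: A u by rewrite linearD linearZ.
rewrite /J !hD.
rewrite innerDl innerZl sqr_normD innerZr normrZ.
by rewrite exprMn real_normK ?num_real//; lra.
Qed.

End Variational.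

(** * Least squares on the kernel of a bounded operator *)

(** A Gram-Schmidt step. The last clause says that T w lies in the biorthogonal
    of the vectors T x; it stands in for membership of w in the span of s, and
    gives the induction what it needs: the new residual, already orthogonal
    to T s, is orthogonal to T p as well, hence to T x as soon as it is
    orthogonal to r = T x - T p. *)
Lemma orthogonal_residual_seq {R : realType} {F : lmodType R} {V : lmodType R}
    {H : innerType R} (L : {linear F -> V}) (T : {linear F -> H}) (s : seq F) :
  (forall x, x \in s -> ker L x) ->
  forall u, exists w, [/\ ker L w,
    forall x, x \in s -> inner (u - T w) (T x) = 0
    & forall z, (forall x, x \in s -> inner z (T x) = 0) -> inner z (T w) = 0].
Proof.
elim: s => [|x s IH] sL u.
  by exists 0; split=> // [|z _]; rewrite ?linear0 ?inner0r// /ker /= linear0.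
have {}IH := IH (fun y ys => sL y (mem_behead (s := x :: s) ys)).
have Lx : ker L x by apply: sL; rewrite mem_head.
have [p [Lp rs pT]] := IH (T x); have [q [Lq r's qT]] := IH u.
(* When r = 0 the coefficient c is 0 by the convention on division, and T x is
   already handled by the previous vectors. *)
pose r := T x - T p; pose c := inner (u - T q) r / inner r r.
have res : u - T (q + c *: (x - p)) = u - T q - c *: r.
  by rewrite linearD linearZ linearB opprD addrA.
have ress y : y \in s -> inner (u - T q - c *: r) (T y) = 0.
  by move=> ys; rewrite innerDl innerNl innerZl r's// rs// mulr0 subrr.
exists (q + c *: (x - p)); split.
- by rewrite /ker /= linearD linearZ linearB /= Lq Lx Lp subrr scaler0 addr0.
- rewrite res => y; rewrite inE => /predU1P[->|]; last exact: ress.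
  rewrite -[T x](subrK (T p)) -/r innerDr (pT _ ress) addr0.
  rewrite innerDl innerNl innerZl /c.
  have [/inner_eq0 ->|r0] := eqVneq (inner r r) 0.
    by rewrite !inner0r mulr0 subrr.
  by rewrite divfK// subrr.
- move=> z zs; rewrite linearD linearZ linearB /= innerDr innerZr innerDr.
  have zs' y : y \in s -> inner z (T y) = 0.
    by move=> ys; rewrite zs// inE ys orbT.
  by rewrite innerNr qT// pT// zs ?mem_head// subrr mulr0 addr0.
Qed.

Lemma riesz_kernel {R : realType} {F H : hilbertType R} {V : normedModType R}
    (L : {linear F -> V}) (T : {linear F -> H}) (v : H) :
  continuous L -> continuous T ->
  exists2 w, ker L w & forall u, ker L u -> inner w u = inner (T u) v.
Proof.
move=> Lc Tc.
apply: (@coercive_variational R F F H V L idfun T v 1 Lc _ Tc ltr01).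
- by move=> x; exact: cvg_id.
- by move=> u _; rewrite mul1r.
Qed.

(** The orthogonal projections onto ker L of vectors spanning F span ker L:
    the same coefficients serve, since the difference of the two combinations
    is both in ker L and orthogonal to it. *)
Lemma finite_dim_kernel_span {R : realType} {F : hilbertType R}
    {V : normedModType R} (L : {linear F -> V}) :
  continuous L -> finite_dim F ->
  exists n (g : 'I_n -> F), (forall i, ker L (g i)) /\
    forall k, ker L k -> exists a : 'I_n -> R, k = \sum_i a i *: g i.
Proof.
move=> Lc [n [e eF]].
have idc : continuous (idfun : F -> F) by move=> x; exact: cvg_id.
have /choice[pr prP] (i : 'I_n) : exists p, ker L p /\
    forall u, ker L u -> inner p u = inner u (e i).
  have [w Lw we] := @riesz_kernel R F F V L idfun (e i) Lc idc.
  by exists w; split.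
exists n, pr; split=> [i|k Lk]; first exact: (prP i).1.
have [a ka] := eF k; exists a.
pose k' := k - \sum_i a i *: pr i.
have Lk' : ker L k'.
  rewrite /ker /= linearB linear_sum /= big1 ?Lk ?subrr// => i _.
  by rewrite linearZ /= (prP i).1 scaler0.
apply/eqP; rewrite -subr_eq0 -/k'; apply/eqP/inner_eq0.
rewrite {2}/k' {1}ka -sumrB inner_sumr big1// => i _.
by rewrite -scalerBr innerZr innerDr innerNr (innerC _ (pr i)) (prP i).2// subrr mulr0.
Qed.

(** Some point of f + ker L minimizes the norm of T, and the equation below is
    its optimality condition. In finite dimension T f is projected onto the
    span of finitely many vectors; in infinite dimension T (ker L) has to be
    closed, which coercivity of T ensures. *)
Lemma constrained_normal_equation {R : realType} {F H : hilbertType R}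
    {V : normedModType R} (L : {linear F -> V}) (T : {linear F -> H}) :
  continuous L -> continuous T ->
  (~ finite_dim F -> exists2 d : R, 0 < d &
     forall u, ker L u -> d * `|u| <= `|T u|) ->
  forall f, exists2 h, ker L h &
    forall k, ker L k -> inner (T (f + h)) (T k) = 0.
Proof.
move=> Lc Tc coer f; have [fd|/coer[d d0 dT]] := pselect (finite_dim F).
- have [n [g [Lg gK]]] := finite_dim_kernel_span L Lc fd.
  have sL x : x \in codom g -> ker L x by move=> /codomP[i ->].
  have [w [Lw ws _]] := @orthogonal_residual_seq R F V H L T _ sL (T f).
  exists (- w) => [|k /gK[a ->]]; first by rewrite /ker /= linearN Lw oppr0.
  rewrite linear_sum inner_sumr big1// => i _.
  by rewrite linearZ innerZr linearB ws ?mulr0// codom_f.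
- have [w Lw wT] := @coercive_variational R F H H V L T T (- T f) d Lc Tc Tc d0 dT.
  exists w => // k Lk.
  by rewrite linearD innerDl wT// innerNr (innerC (T k)) subrr.
Qed.

(** * The first matrix inequality of the semidefinite program *)

Section Adjoint.
Context {R : realType} {F H : hilbertType R} {V : normedModType R}.
Context (L : {linear F -> V}) (A : {linear F -> H}).

(** The adjoints in the semidefinite program are only chosen when a representing
    vector exists; by Riesz on the kernel one does. *)
Lemma adjoint_restrE : continuous L -> continuous A -> forall u v,
  inner (adjoint (restr L A) v) u = inner v (restr L A u).
Proof.
move=> Lc Ac u v; rewrite innerC (innerC v) /adjoint; case: xgetP => [w _ -> //|].
have [w Lw wA] := @riesz_kernel R F H V L A v Lc Ac.
have kw : in_kernel L w by apply/eqP.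
move=> /(_ (Defs.Kernel kw))[] x; rewrite (innerC x); symmetry.
by apply: (wA (val x)); apply/eqP; case: x.
Qed.

End Adjoint.

Section SDP.
Context {R : realType} {F H0 H1 Z : hilbertType R} {m0 m1 : nat}.
Context (P0 : {linear F -> H0}) (P1 : {linear F -> H1}).
Context (L0 : {linear F -> 'cV[R]_m0}) (L1 : {linear F -> 'cV[R]_m1}).
Context (Q : {linear F -> Z}).
Hypotheses (P0c : continuous P0) (P1c : continuous P1).
Hypotheses (L0c : continuous L0) (L1c : continuous L1) (Qc : continuous Q).

(** The quadratic form of the block operator at (h0, h1) is
    c0 |P0 h0|^2 + c1 |P1 (h0 - h1)|^2, so the positivity half of the
    semidefinite order is domination of the quantity of interest by the two
    model penalties. *)
Lemma sdp_constraint1_le (c0 c1 : R) : sdp_constraint1 P0 P1 L0 L1 Q c0 c1 ->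
  forall h0 h1, ker L0 h0 -> ker L1 h1 ->
  `|Q h0| ^+ 2 <= c0 * `|P0 h0| ^+ 2 + c1 * `|P1 (h0 - h1)| ^+ 2.
Proof.
move=> [_ pos] h0 h1 Lh0 Lh1.
have k0 : in_kernel L0 h0 by apply/eqP.
have k1 : in_kernel L1 h1 by apply/eqP.
have := pos (Defs.Kernel k0, Defs.Kernel k1).
rewrite innerDl innerNl /block2 [X in X - _]/inner [X in _ - X]/inner /=.
rewrite !innerDl !innerNl !innerZl !inner0l.
rewrite !adjoint_restrE// /restr /= -!sqr_norm_inner.
rewrite linearB sqr_normD innerNr normrN (innerC (P1 h1)); lra.
Qed.

End SDP.

(** * Decoupling of the two models *)

Section ProductNorm.
Context {R : realType} {F : hilbertType R}.

Lemma norm_le_inorm_fst (u v : F) : `|u| <= inorm ((u, v) : F * F).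
Proof.
rewrite -[`|u|]normr_id -sqrtr_sqr sqr_norm_inner ler_wsqrtr//.
by rewrite [leRHS]/inner /= lerDl inner_ge0.
Qed.

Lemma norm_le_inorm_snd (u v : F) : `|v| <= inorm ((u, v) : F * F).
Proof.
rewrite -[`|v|]normr_id -sqrtr_sqr sqr_norm_inner ler_wsqrtr//.
by rewrite [leRHS]/inner /= lerDr inner_ge0.
Qed.

End ProductNorm.

Section Decoupling.
Context {R : realType} {F H0 H1 Z : hilbertType R} {m0 m1 : nat}.
Context (P0 : {linear F -> H0}) (P1 : {linear F -> H1}).
Context (L0 : {linear F -> 'cV[R]_m0}) (L1 : {linear F -> 'cV[R]_m1}).
Context (Q : {linear F -> Z}) (eps0 eps1 : R).
Hypotheses (eps0_gt0 : 0 < eps0) (eps1_gt0 : 0 < eps1).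

(** In the first case 0 is a preimage in ker L1 of the vanishing P1 h, in the
    second one h itself is. This inclusion of images is the form in which the
    alternative is used: a perturbation h0 of the first component can be
    followed by a perturbation of the second one that leaves P1 (f0 - f1)
    unchanged. *)
Lemma image_ker_sub : ker L0 `<=` ker P1 \/ ker L0 `<=` ker L1 ->
  P1 @` ker L0 `<=` P1 @` ker L1.
Proof.
case=> sub _ [h Lh <-]; last by exists h => //; exact: sub.
by exists 0; [rewrite /ker /= linear0|rewrite linear0 sub].
Qed.

Hypothesis P1_ker : P1 @` ker L0 `<=` P1 @` ker L1.

(** Well-posedness controls h0 by both penalties at once; choosing h1 in ker L1
    with P1 h1 = P1 h0 makes the second one vanish. *)
Lemma well_posed_coercive0 : well_posed P0 P1 L0 L1 eps0 eps1 ->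
  ~ finite_dim F -> exists2 d : R, 0 < d &
  forall u, ker L0 u -> d * `|u| <= `|P0 u|.
Proof.
move=> [_ wp] /wp[d d0 dP]; exists (eps0 * d); first exact: mulr_gt0.
move=> u Lu; have [k Lk Pk] := P1_ker _ (imageP _ Lu).
have := dP u k Lu Lk; rewrite linearB Pk subrr normr0 mulr0.
have e0P : 0 <= eps0^-1 * `|P0 u| by rewrite mulr_ge0// invr_ge0 ltW.
rewrite (max_idPl e0P) -mulrA ler_pdivlMl//.
apply: le_trans; rewrite ler_pM2l// ler_pM2l//.
exact: norm_le_inorm_fst.
Qed.

(** Well-posedness at pairs (0, h1), where the first penalty vanishes. *)
Lemma well_posed_coercive1 : well_posed P0 P1 L0 L1 eps0 eps1 ->
  ~ finite_dim F -> exists2 d : R, 0 < d &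
  forall u, ker L1 u -> d * `|u| <= `|P1 u|.
Proof.
move=> [_ wp] /wp[d d0 dP]; exists (eps1 * d); first exact: mulr_gt0.
move=> u Lu; have := dP 0 u (linear0 L0) Lu.
rewrite linear0 normr0 mulr0 sub0r linearN normrN.
have e1P : 0 <= eps1^-1 * `|P1 u| by rewrite mulr_ge0// invr_ge0 ltW.
rewrite (max_idPr e1P) -mulrA ler_pdivlMl//.
apply: le_trans; rewrite ler_pM2l// ler_pM2l//.
exact: norm_le_inorm_snd.
Qed.

(** The two penalties are stationary separately, with f.1 frozen in the second
    one: f.1 is a data-consistent point of least |P0 f.1|, and
    f.2 is then fitted to it. *)
Definition decoupled_stationary (f : F * F) : Prop :=
  (forall k, ker L0 k -> inner (P0 f.1) (P0 k) = 0) /\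
  (forall k, ker L1 k -> inner (P1 (f.1 - f.2)) (P1 k) = 0).

Lemma decoupled_stationary_exists (y : 'cV[R]_(m0 + m1)) :
  continuous P0 -> continuous P1 -> continuous L0 -> continuous L1 ->
  well_posed P0 P1 L0 L1 eps0 eps1 ->
  data_consistent L0 L1 y !=set0 ->
  exists2 f, data_consistent L0 L1 y f & decoupled_stationary f.
Proof.
move=> P0c P1c L0c L1c wp [[g0 g1] [/= Lg0 Lg1]].
have [h0 Lh0 st0] := @constrained_normal_equation R F H0 _ L0 P0 L0c P0c
  (well_posed_coercive0 wp) g0.
have [h1 Lh1 st1] := @constrained_normal_equation R F H1 _ L1 P1 L1c P1c
  (well_posed_coercive1 wp) (g0 + h0 - g1).
exists (g0 + h0, g1 - h1); split => //=.
- by rewrite linearD Lg0 Lh0 addr0.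
- by rewrite linearB Lg1 Lh1 subr0.
- by move=> k Lk; rewrite opprB addrCA addrC st1.
Qed.

Lemma data_consistent_sub {y : 'cV[R]_(m0 + m1)} {f g : F * F} :
  data_consistent L0 L1 y f -> data_consistent L0 L1 y g ->
  ker L0 (g.1 - f.1) /\ ker L1 (g.2 - f.2).
Proof.
move=> [f0 f1] [h0 h1].
by split; rewrite /ker /= linearB ?f0 ?f1 ?h0 ?h1 subrr.
Qed.

Section Stationary.
Context {y : 'cV[R]_(m0 + m1)} {f : F * F}.
Hypotheses (yf : data_consistent L0 L1 y f) (stf : decoupled_stationary f).

(** P1 maps h0 - h1 to the image of a vector of ker L1, so that the second
    penalty is stationary along joint perturbations as well. *)
Lemma stationary_orth1 h0 h1 : ker L0 h0 -> ker L1 h1 ->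
  inner (P1 (f.1 - f.2)) (P1 (h0 - h1)) = 0.
Proof.
move=> Lh0 Lh1; have [k Lk Pk] := P1_ker _ (imageP _ Lh0).
have -> : P1 (h0 - h1) = P1 (k - h1) by rewrite !linearB /= Pk.
apply: stf.2.
by rewrite /ker /= linearB Lk Lh1 subrr.
Qed.

(** Pythagoras for both penalties at once: a single f minimizes the regularized
    functional for every tau in [0, 1]. *)
Lemma regularized_stationary (tau : R) (g : F * F) :
  data_consistent L0 L1 y g ->
  regularized P0 P1 tau g =
    regularized P0 P1 tau f + regularized P0 P1 tau (g - f).
Proof.
move=> yg; have [Lh0 Lh1] := data_consistent_sub yf yg.
have o0 := stf.1 _ Lh0; have o1 := stationary_orth1 _ _ Lh0 Lh1.
rewrite /regularized /=.
rewrite -[in LHS](subrK f.1 g.1) [_ + f.1]addrC.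
have -> : f.1 + (g.1 - f.1) - g.2 = f.1 - f.2 + (g.1 - f.1 - (g.2 - f.2)).
  by rewrite opprB [RHS]addrACA addKr.
rewrite (linearD P0) (linearD P1) !sqr_normD o0 o1; ring.
Qed.

(** The set of first components of compatible pairs is symmetric about f.1.
    Reflection keeps |P0 _| because P0 f.1 is orthogonal to P0 (ker L0), and
    shifting the second component by twice a vector k of ker L1 with
    P1 k = P1 (g.1 - f.1) keeps P1 (g.1 - g.2) exactly. *)
Lemma compatible_reflect (g : F * F) : compatible P0 P1 L0 L1 eps0 eps1 y g ->
  exists g2, compatible P0 P1 L0 L1 eps0 eps1 y (f.1 - (g.1 - f.1), g2).
Proof.
move=> [g0 g1 yg]; have [Lh0 _] := data_consistent_sub yf yg.
have [k Lk Pk] := P1_ker _ (imageP _ Lh0); exists (g.2 - (k + k)).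
have gE : g.1 = f.1 + (g.1 - f.1) by rewrite addrC subrK.
move: (g.1 - f.1) gE Lh0 Pk => h gE Lh0 Pk.
rewrite /compatible /model0 /model1 /=; split=> /=.
- move: g0; rewrite /model0 /= gE.
  suff -> : `|P0 (f.1 - h)| = `|P0 (f.1 + h)| by [].
  apply/eqP; rewrite -(@eqrXn2 _ 2)//; apply/eqP.
  by rewrite (linearB P0) (linearD P0) !sqr_normD innerNr stf.1// normrN oppr0.
- move: g1; rewrite /model1 /= gE.
  suff -> : P1 (f.1 - h - (g.2 - (k + k))) =
            P1 (f.1 + h - g.2) by [].
  by rewrite !(linearB P1) !(linearD P1) /= Pk opprB -!addrA addKr.
- split=> /=; first by rewrite linearB /= Lh0 subr0 yf.1.
  by rewrite linearB linearD /= Lk addr0 subr0 yg.2.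
Qed.

(** The center of a symmetric set is a Chebyshev center: for two points
    reflected in Q f.1, the larger of their distances to z is at least half
    the distance between them, which is their common distance to Q f.1. *)
Lemma lwce_stationary_le z :
  (lwce P0 P1 L0 L1 Q eps0 eps1 y (Q f.1) <=
   lwce P0 P1 L0 L1 Q eps0 eps1 y z)%E.
Proof.
apply: ge_ereal_sup => _ [g gy <-].
have [g2 g'y] := compatible_reflect _ gy.
set h := g.1 - f.1 in g'y.
have le2 : 2 * `|Q g.1 - Q f.1| <= `|Q g.1 - z| + `|Q (f.1 - h) - z|.
  have -> : 2 * `|Q g.1 - Q f.1| = `|(Q g.1 - z) - (Q (f.1 - h) - z)|.
    rewrite mulr_natl -normrMn; congr `|_|.
    rewrite /h !(linearB Q) /= !opprB addrA subrK mulr2n.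
    by rewrite -!addrA; congr (_ + _); exact: addrCA.
  exact: ler_normB.
have [le|gt] := leP `|Q g.1 - Q f.1| `|Q g.1 - z|.
  apply: (@le_trans _ _ (`|Q g.1 - z|)%:E); first by rewrite lee_fin.
  by apply: ereal_sup_ubound; exists g.
apply: (@le_trans _ _ (`|Q (f.1 - h) - z|)%:E); first by rewrite lee_fin; lra.
by apply: ereal_sup_ubound; exists (f.1 - h, g2).
Qed.

(** Minimizers of the regularized functional may differ, but not their image
    under Q: by Pythagoras the difference h of first components of two
    minimizers satisfies c0 |P0 h|^2 = 0, and the domination hypothesis at
    (h, k), with P1 k = P1 h, then gives Q h = 0. This covers c0 = 0, where P0
    leaves h free and it is Q that vanishes on ker L0. *)
Lemma argmin_regularized_stationary (c0 c1 : R) :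
  0 <= c0 -> 0 <= c1 -> 0 < c0 + c1 ->
  (forall h0 h1, ker L0 h0 -> ker L1 h1 ->
    `|Q h0| ^+ 2 <= c0 * `|P0 h0| ^+ 2 + c1 * `|P1 (h0 - h1)| ^+ 2) ->
  [set Q g.1 | g in argmin_regularized P0 P1 L0 L1 (c1 / (c0 + c1)) y] =
  [set Q f.1].
Proof.
move=> c0_ge0 c1_ge0 c_gt0 dom; set tau := c1 / _.
have ctau : 1 - tau = c0 / (c0 + c1) by rewrite /tau; field; rewrite gt_eqF.
have tau_ge0 : 0 <= tau by rewrite divr_ge0// ltW.
have tau_le1 : 0 <= 1 - tau by rewrite ctau divr_ge0// ltW.
apply/seteqP; split=> [_ [g [yg gmin] <-]|_ ->] /=; last first.
  exists f => //; split=> // g yg; rewrite (regularized_stationary _ _ yg).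
  by rewrite lerDl addr_ge0// mulr_ge0// sqr_ge0.
have [Lh0 _] := data_consistent_sub yf yg.
have := gmin _ yf; rewrite (regularized_stationary _ _ yg) gerDl.
rewrite /regularized /= => le0.
have [k Lk Pk] := P1_ker _ (imageP _ Lh0).
have := dom _ _ Lh0 Lk; rewrite (linearB P1) Pk subrr normr0 expr0n mulr0 addr0.
have cP0 : c0 * `|P0 (g.1 - f.1)| ^+ 2 <= 0.
  have : (1 - tau) * `|P0 (g.1 - f.1)| ^+ 2 <= 0.
    by apply: le_trans le0; rewrite lerDl mulr_ge0// sqr_ge0.
  by rewrite ctau mulrAC pmulr_lle0// invr_gt0.
move=> /le_trans /(_ cP0); rewrite le_eqVlt ltNge sqr_ge0 orbF sqrf_eq0.
by rewrite normr_eq0 linearB subr_eq0 => /eqP.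
Qed.

End Stationary.
End Decoupling.

Theorem theorem8 (R : realType) (F H0 H1 Z : hilbertType R) (m0 m1 : nat)
    (P0 : {linear F -> H0}) (P1 : {linear F -> H1})
    (L0 : {linear F -> 'cV[R]_m0}) (L1 : {linear F -> 'cV[R]_m1})
    (Q : {linear F -> Z}) (eps0 eps1 : R)
    (P0_bounded : bounded_near P0 (nbhs (0 : F)))
    (P1_bounded : bounded_near P1 (nbhs (0 : F)))
    (L0_bounded : bounded_near L0 (nbhs (0 : F)))
    (L1_bounded : bounded_near L1 (nbhs (0 : F)))
    (Q_bounded : bounded_near Q (nbhs (0 : F)))
    (eps0_gt0 : 0 < eps0) (eps1_gt0 : 0 < eps1)
    (P_L_well_posed : well_posed P0 P1 L0 L1 eps0 eps1)
    (ker_L0 : ker L0 `<=` ker P1 \/ ker L0 `<=` ker L1)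
    (b c0 c1 : 'cV[R]_(m0 + m1) -> R) :
  let D := [set y | [/\ compatible P0 P1 L0 L1 eps0 eps1 y !=set0,
                        sdp_solution P0 P1 L0 L1 Q eps0 eps1
                          y (b y) (c0 y) (c1 y)
                      & 0 < c0 y + c1 y]] in
  let tau y := c1 y / (c0 y + c1 y) in
  exists Delta : 'cV[R]_(m0 + m1) -> Z,
    (forall y, D y ->
       [set Q f.1 | f in argmin_regularized P0 P1 L0 L1 (tau y) y]
         = [set Delta y]) /\
    locally_optimal_on P0 P1 L0 L1 Q eps0 eps1 D Delta.
Proof.
move=> D tau.
have P0c : continuous P0 by exact/linear_bounded_continuous.
have P1c : continuous P1 by exact/linear_bounded_continuous.
have L0c : continuous L0 by exact/linear_bounded_continuous.
have L1c : continuous L1 by exact/linear_bounded_continuous.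
have Qc : continuous Q by exact/linear_bounded_continuous.
have P1_ker := image_ker_sub _ _ _ ker_L0.
have center y : exists z, D y ->
    [set Q f.1 | f in argmin_regularized P0 P1 L0 L1 (tau y) y] = [set z] /\
    forall z', (lwce P0 P1 L0 L1 Q eps0 eps1 y z <=
                lwce P0 P1 L0 L1 Q eps0 eps1 y z')%E.
  have [Dy|nDy] := pselect (D y); last by exists 0.
  have [[g [_ _ yg]] [[_ c0_ge0 c1_ge0 sdp1 _] _] c_gt0] := Dy.
  have [|f yf stf] := @decoupled_stationary_exists R F H0 H1 m0 m1 P0 P1 L0 L1
    eps0 eps1 eps0_gt0 eps1_gt0 P1_ker y P0c P1c L0c L1c P_L_well_posed.
    by exists g.
  exists (Q f.1) => _; split=> [|z'].
    apply: (argmin_regularized_stationary _ _ _ _ _ P1_ker yf stf) => //.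
    exact: sdp_constraint1_le.
  exact: (lwce_stationary_le _ _ _ _ _ _ _ P1_ker yf stf).
have [Delta DeltaP] := choice center.
exists Delta; split=> [y /DeltaP[]//|y /DeltaP[_ opt] z]; exact: opt.
Qed.
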